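(* Let $n\ge2$. The set $\mathcal{M}_{NC}(I_n)$ of negatively correlated probability measures on the Boolean cube $I_n=\{0,1\}^n$ is not convex. However, for any fixed $p_1,\dots,p_n\in\mathbb{R}$, the collection $$E_{p_1,\dots,p_n}=\{\mu\in\mathcal{M}_{NC}(I_n):\mu^{(i)}(1)=p_i,\ i=1,\dots,n\}$$ is convex.
   Context: For a probability measure $\mu$ on $I_n=\{0,1\}^n$, $\mu^{(i)}(1)=\mu(x_i=1)$ and $\mu^{(i,j)}(1,1)=\mu(x_i=x_j=1)$ are values of its one- and two-dimensional marginals. $\mu$ is negatively correlated (NC) if $\mu^{(i,j)}(1,1)\le\mu^{(i)}(1)\mu^{(j)}(1)$ for all $i\ne j$. Convexity is with respect to convex combinations $\lambda\mu+(1-\lambda)\nu$, $0\le\lambda\le1$, of measures. *)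

(* Defs.v *)
From HB Require Import structures.
From mathcomp Require Import all_boot all_order all_algebra.
From mathcomp Require Import all_classical all_reals all_analysis.

Set Implicit Arguments.
Unset Strict Implicit.
Unset Printing Implicit Defensive.

Import Order.TTheory GRing.Theory Num.Theory.
Import numFieldNormedType.Exports.
Local Open Scope classical_set_scope.
Local Open Scope ring_scope.
Local Open Scope ereal_scope.

Section mixture.
Context d (T : measurableType d) (R : realType).
Implicit Types (mu nu : probability T R) (t : {i01 R}).

Definition mixture t mu nu : set T -> \bar R :=
  measure_add (mscale (t%:num%:nng)%R mu) (mscale ((1 - t%:num)%:nng)%R nu).

HB.instance Definition _ t mu nu := Measure.on (mixture t mu nu).

Lemma mixtureE t mu nu (A : set T) :
  mixture t mu nu A = (t%:num)%R%:E * mu A + (1 - t%:num)%R%:E * nu A.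
Proof. by rewrite /mixture measure_addE. Qed.

Let mixture_setT t mu nu : mixture t mu nu [set: T] = 1.
Proof.
by rewrite mixtureE !probability_setT !mule1 -EFinD addrC subrK.
Qed.

HB.instance Definition _ t mu nu :=
  Measure_isProbability.Build _ _ _ (mixture t mu nu) (mixture_setT t mu nu).

(* [convex_set] requires an lmodType, which [probability T R] is not. *)
Definition convex_probabilities (S : set (probability T R)) : Prop :=
  forall mu nu, S mu -> S nu -> forall t, S (mixture t mu nu).

End mixture.

(* The cube carries the library's product sigma-algebra on tuples, which here
   is the full powerset (measurable_cube below). *)
Notation cube n := (n.-tuple bool).

Lemma measurable_cube n (A : set (cube n)) : measurable A.
Proof.
have m1 (x : cube n) : measurable [set x].
  have -> : [set x] = \bigcap_(i in [set: 'I_n])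
      ((fun y : cube n => tnth y i) @^-1` [set tnth x i]).
    apply/seteqP; split=> [y /= -> //|y /= xy].
    by apply: eq_from_tnth => i; exact: xy.
  apply: fin_bigcap_measurable => // i _.
  by rewrite -[X in measurable X]setTI; exact: measurable_tnth.
have -> : A = \bigcup_(x in A) [set x] by rewrite bigcup_imset1 image_id.
by apply: fin_bigcup_measurable => //; exact: finite_finset.
Qed.

Section negative_correlation.
Context (R : realType) (n : nat).
Implicit Types (mu : probability (cube n) R) (i j : 'I_n).

(* The values at 1, resp. (1, 1), of the i-th, resp. (i, j)-th, marginal. *)
Definition marginal1 mu i : \bar R := mu [set x | tnth x i = true].

Definition marginal2 mu i j : \bar R :=
  mu [set x | tnth x i = true /\ tnth x j = true].

Definition negatively_correlated mu : Prop :=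
  forall i j, i != j -> marginal2 mu i j <= marginal1 mu i * marginal1 mu j.

Definition NC_measures : set (probability (cube n) R) :=
  [set mu | negatively_correlated mu].

Definition NC_measures_with_marginals (p : 'I_n -> R) :
    set (probability (cube n) R) :=
  [set mu | NC_measures mu /\ forall i, marginal1 mu i = (p i)%:E].

End negative_correlation.
Arguments NC_measures : clear implicits.
Arguments NC_measures_with_marginals : clear implicits.

(* Main.v *)
Require Import Defs.
From mathcomp Require Import all_boot all_order all_algebra.
From mathcomp Require Import all_classical all_reals all_analysis.

(** The one- and two-dimensional marginals are affine in the measure, while the
    bound in negative correlation is quadratic in it.  Once the one-dimensional
    marginals are prescribed, the quadratic side becomes a constant, so the
    defining conditions are affine equalities and inequalities and cut out a
    convex set: [NC_measures_with_marginals_convex].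

    Without prescribed marginals convexity fails.  A point mass makes the
    coordinates deterministic, hence independent and negatively correlated
    ([dirac_NC]).  But the fair mixture of the point masses at the all-zeros
    and the all-ones vertices makes the coordinates equal to one and the same
    fair bit, so that two of them are both 1 with probability 1/2 rather than
    at most 1/4. *)

Set Implicit Arguments.
Unset Strict Implicit.
Unset Printing Implicit Defensive.

Import Order.TTheory GRing.Theory Num.Theory.
Local Open Scope classical_set_scope.
Local Open Scope ring_scope.
Local Open Scope ereal_scope.

Section convexity.
Context (R : realType) (n : nat).
Implicit Types (mu nu : probability (cube n) R) (t : {i01 R}).

Lemma marginal1_mixture t mu nu i :
  marginal1 (mixture t mu nu) i =
  t%:num%R%:E * marginal1 mu i + (1 - t%:num)%R%:E * marginal1 nu i.
Proof. exact: mixtureE. Qed.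

Lemma marginal2_mixture t mu nu i j :
  marginal2 (mixture t mu nu) i j =
  t%:num%R%:E * marginal2 mu i j + (1 - t%:num)%R%:E * marginal2 nu i j.
Proof. exact: mixtureE. Qed.

Lemma mixture_cst t (a : R) :
  t%:num%R%:E * a%:E + (1 - t%:num)%R%:E * a%:E = a%:E.
Proof. by rewrite -!EFinM -EFinD -mulrDl addrC subrK mul1r. Qed.

Lemma mixture_le t (x y : \bar R) (a : R) : x <= a%:E -> y <= a%:E ->
  t%:num%R%:E * x + (1 - t%:num)%R%:E * y <= a%:E.
Proof.
move=> xa ya; rewrite -[leRHS](mixture_cst t).
by apply: leeD; apply: lee_wpmul2l; rewrite // lee_fin.
Qed.

(** The product of the marginals is the same constant for both measures, so the
    two bounds on the affine quantity [marginal2] average to that constant. *)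
Lemma NC_measures_with_marginals_convex (p : 'I_n -> R) :
  convex_probabilities (NC_measures_with_marginals R n p).
Proof.
move=> mu nu [mu_nc mu_p] [nu_nc nu_p] t.
have mix_p i : marginal1 (mixture t mu nu) i = (p i)%:E.
  by rewrite marginal1_mixture mu_p nu_p mixture_cst.
split=> // i j ij; rewrite !mix_p marginal2_mixture -EFinM.
apply: mixture_le; rewrite EFinM.
- by rewrite -!mu_p; exact: mu_nc.
- by rewrite -!nu_p; exact: nu_nc.
Qed.

End convexity.

Section nonconvexity.
Context (R : realType) (n : nat).

Lemma marginal1_dirac (a : cube n) i :
  marginal1 (dirac a : probability (cube n) R) i = (tnth a i)%:R%:E.
Proof.
by rewrite /marginal1 /= diracE; congr ((nat_of_bool _)%:R%:E); apply/idP/idP; rewrite inE.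
Qed.

Lemma marginal2_dirac (a : cube n) i j :
  marginal2 (dirac a : probability (cube n) R) i j =
  (tnth a i && tnth a j)%:R%:E.
Proof.
rewrite /marginal2 /= diracE; congr ((nat_of_bool _)%:R%:E).
by apply/idP/andP; rewrite inE.
Qed.

Lemma dirac_NC (a : cube n) : NC_measures R n (dirac a).
Proof.
by move=> i j _; rewrite marginal2_dirac !marginal1_dirac -EFinM -natrM mulnb.
Qed.

(** Two distinct coordinates are needed to see the failure: in dimension at
    most 1 every measure is negatively correlated. *)
Lemma NC_measures_not_convex : (2 <= n)%N ->
  ~ convex_probabilities (NC_measures R n).
Proof.
move=> n2 convexNC; have n1 : (0 < n)%N by exact: ltnW.
have half1 : (2^-1 <= 1 :> R)%R by rewrite invf_le1 ?ltr0n// ler1n.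
have half0 : (0 <= 2^-1 :> R)%R by rewrite invr_ge0 ler0n.
have := convexNC _ _ (dirac_NC [tuple of nseq n true])
  (dirac_NC [tuple of nseq n false]) (Itv01 half0 half1).
move=> /(_ (Ordinal n1) (Ordinal n2) isT).
rewrite !marginal1_mixture marginal2_mixture !marginal2_dirac !marginal1_dirac !tnth_nseq /=.
rewrite !mule1 !mule0 !adde0 -EFinM lee_fin.
(* What is left is the contradictory bound 1/2 <= 1/2 * 1/2. *)
by rewrite leNgt gtr_pMr ?invr_gt0 ?ltr0n// invf_lt1 ?ltr0n// ltr1n.
Qed.

End nonconvexity.

Theorem corollary3 (R : realType) (n : nat) (hn : (2 <= n)%N) :
  ~ convex_probabilities (NC_measures R n) /\
  (forall p : 'I_n -> R, convex_probabilities (NC_measures_with_marginals R n p)).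
Proof.
split; first exact: NC_measures_not_convex.
by move=> p; exact: NC_measures_with_marginals_convex.
Qed.
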